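(* Work in ZF (the Axiom of Choice is not assumed). Let $\lambda$ and $\nu$ be well-ordered cardinals (initial ordinals) and let $\mathfrak m$ be an arbitrary cardinal. If $\mathrm{Cov}(<\!\lambda,\mathfrak m,\nu)$ holds, then $\nu\le^{*}\lambda\cdot\mathfrak m$, and consequently $\nu^+\le\aleph^*(\lambda\cdot\mathfrak m)$.
   Context: For a set $X$, $|X|$ denotes its cardinal; $|X|=|Y|$ means there is a bijection between $X$ and $Y$. A cardinal is well-ordered if it is the cardinal of a well-orderable set; such cardinals are identified with initial von Neumann ordinals. $|X|\le|Y|$ means $X$ is empty or there is an injection of $X$ into $Y$; $|X|<|Y|$ means $|X|\le|Y|$ and $|X|\neq|Y|$. $|X|\le^{*}|Y|$ means $X$ is empty or there is a surjection of $Y$ onto $X$. Products: $|X|\cdot|Y|=|X\times Y|$. The Lindenbaum function is $\aleph^*(\mathfrak n)=\{\alpha\in\mathrm{Ord}: |\alpha|\le^{*}\mathfrak n\}$ (the least ordinal $\alpha$ with $|\alpha|\not\le^*\mathfrak n$); the Hartogs function is $\aleph(\mathfrak n)=\{\alpha\in\mathrm{Ord}:|\alpha|\le\mathfrak n\}$, and for well-ordered $\nu$, $\nu^+$ denotes $\aleph(\nu)$. For a class $\mathfrak L$ of cardinals and cardinals $\mathfrak m,\mathfrak n$, $\mathrm{Cov}(\mathfrak L,\mathfrak m,\mathfrak n)$ means: a set of size $\mathfrak n$ can be covered by $\mathfrak m$ sets whose sizes belong to $\mathfrak L$, i.e. there are a set $X$ with $|X|=\mathfrak n$ and a family $\langle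 A_i:i\in I\rangle$ with $|I|=\mathfrak m$, each $|A_i|\in\mathfrak L$, and $X\subseteq\bigcup_{i\in I}A_i$. $\mathrm{Cov}(\mathfrak l,\mathfrak m,\mathfrak n)$ means $\mathrm{Cov}(\{\mathfrak l\},\mathfrak m,\mathfrak n)$, and $\mathrm{Cov}(<\!\mathfrak l,\mathfrak m,\mathfrak n)$ means $\mathrm{Cov}(\{\mathfrak k:\mathfrak k<\mathfrak l\},\mathfrak m,\mathfrak n)$. *)

(* Defs.v *)
(* Uses only the prelude. ZF is first-order ZF: statements are about an arbitrary model of
   the ZF axioms, and Separation and Replacement range over deeply embedded formulas
   of the language of set theory (with parameters). Ranging over all Rocq
   predicates instead would make the Axiom of Choice true in every model as soon
   as Rocq's own choice axioms are available. *)

Record structure : Type := Structure {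
  carrier :> Type;
  mem : carrier -> carrier -> Prop
}.

Arguments mem {_} _ _.

Notation "x ∈ y" := (mem x y) (at level 70, no associativity).

(* Variables are de Bruijn indices: fAll and fEx bind index 0. *)
Inductive formula : Type :=
  | fMem (i j : nat)
  | fEq (i j : nat)
  | fNot (p : formula)
  | fAnd (p q : formula)
  | fOr (p q : formula)
  | fImp (p q : formula)
  | fAll (p : formula)
  | fEx (p : formula).

Definition scons {T : Type} (x : T) (e : nat -> T) (n : nat) : T :=
  match n with
  | O => x
  | S k => e k
  end.

Fixpoint sat {M : structure} (e : nat -> M) (p : formula) : Prop :=
  match p with
  | fMem i j => e i ∈ e j
  | fEq i j => e i = e j
  | fNot p => ~ sat e p
  | fAnd p q => sat e p /\ sat e q
  | fOr p q => sat e p \/ sat e q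
  | fImp p q => sat e p -> sat e q
  | fAll p => forall x : M, sat (scons x e) p
  | fEx p => exists x : M, sat (scons x e) p
  end.

Definition subset {M : structure} (x y : M) : Prop :=
  forall z : M, z ∈ x -> z ∈ y.

Definition is_empty {M : structure} (x : M) : Prop :=
  forall z : M, ~ z ∈ x.

Record ZF (M : structure) : Prop := {
  zf_extensionality :
    forall x y : M, (forall z : M, z ∈ x <-> z ∈ y) -> x = y;
  zf_foundation :
    forall x : M, ~ is_empty x ->
      exists y : M, y ∈ x /\ forall z : M, z ∈ x -> ~ z ∈ y;
  zf_pairing :
    forall x y : M, exists p : M, forall z : M, z ∈ p <-> z = x \/ z = y;
  zf_union :
    forall x : M, exists u : M,
      forall z : M, z ∈ u <-> exists y : M, y ∈ x /\ z ∈ y;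
  zf_power :
    forall x : M, exists p : M, forall z : M, z ∈ p <-> subset z x;
  zf_infinity :
    exists w : M,
      (exists z : M, z ∈ w /\ is_empty z) /\
      forall x : M, x ∈ w ->
        exists y : M, y ∈ w /\ forall z : M, z ∈ y <-> z ∈ x \/ z = x;
  zf_separation :
    forall (p : formula) (e : nat -> M) (a : M),
      exists b : M, forall x : M, x ∈ b <-> x ∈ a /\ sat (scons x e) p;
  zf_replacement :
    forall (p : formula) (e : nat -> M) (a : M),
      (forall x y y' : M, x ∈ a ->
         sat (scons x (scons y e)) p -> sat (scons x (scons y' e)) p ->
         y = y') ->
      exists b : M, forall y : M,
        y ∈ b <-> exists x : M, x ∈ a /\ sat (scons x (scons y e)) p
}.

(* z = {x, y} *)
Definition is_upair {M : structure} (z x y : M) : Prop :=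
  forall u : M, u ∈ z <-> u = x \/ u = y.

(* z is the Kuratowski pair {{x, x}, {x, y}} *)
Definition is_pair {M : structure} (z x y : M) : Prop :=
  forall u : M, u ∈ z <-> is_upair u x x \/ is_upair u x y.

(* P = X * Y *)
Definition is_product {M : structure} (P X Y : M) : Prop :=
  forall z : M, z ∈ P <-> exists x y : M, x ∈ X /\ y ∈ Y /\ is_pair z x y.

Definition app {M : structure} (f x y : M) : Prop :=
  exists z : M, is_pair z x y /\ z ∈ f.

Definition function_on {M : structure} (f X : M) : Prop :=
  (forall z : M, z ∈ f -> exists x y : M, x ∈ X /\ is_pair z x y) /\
  (forall x : M, x ∈ X -> exists y : M, app f x y) /\
  (forall x y y' : M, app f x y -> app f x y' -> y = y').

Definition maps_to {M : structure} (f X Y : M) : Prop :=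
  function_on f X /\ forall x y : M, app f x y -> y ∈ Y.

Definition injection {M : structure} (f X Y : M) : Prop :=
  maps_to f X Y /\ forall x x' y : M, app f x y -> app f x' y -> x = x'.

Definition surjection {M : structure} (f X Y : M) : Prop :=
  maps_to f X Y /\ forall y : M, y ∈ Y -> exists x : M, app f x y.

Definition bijection {M : structure} (f X Y : M) : Prop :=
  injection f X Y /\ surjection f X Y.

(* A cardinal is represented by any set of that size; the following relations
   compare |X| and |Y|. *)
Definition card_eq {M : structure} (X Y : M) : Prop :=
  exists f : M, bijection f X Y.

Definition card_le {M : structure} (X Y : M) : Prop :=
  is_empty X \/ exists f : M, injection f X Y.

Definition card_lt {M : structure} (X Y : M) : Prop :=
  card_le X Y /\ ~ card_eq X Y.

(* |X| <=* |Y| *)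
Definition card_le_star {M : structure} (X Y : M) : Prop :=
  is_empty X \/ exists f : M, surjection f Y X.

Definition transitive_set {M : structure} (a : M) : Prop :=
  forall x : M, x ∈ a -> subset x a.

Definition well_ordered_by_mem {M : structure} (a : M) : Prop :=
  (forall x : M, x ∈ a -> ~ x ∈ x) /\
  (forall x y z : M, x ∈ a -> y ∈ a -> z ∈ a -> x ∈ y -> y ∈ z -> x ∈ z) /\
  (forall x y : M, x ∈ a -> y ∈ a -> x ∈ y \/ x = y \/ y ∈ x) /\
  (forall s : M, subset s a -> ~ is_empty s ->
     exists x : M, x ∈ s /\ forall y : M, y ∈ s -> x = y \/ x ∈ y).

Definition ordinal {M : structure} (a : M) : Prop :=
  transitive_set a /\ well_ordered_by_mem a.

Definition initial_ordinal {M : structure} (k : M) : Prop :=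
  ordinal k /\ forall a : M, a ∈ k -> ~ card_eq a k.

(* h = aleph(|N|) *)
Definition is_hartogs {M : structure} (h N : M) : Prop :=
  forall a : M, a ∈ h <-> ordinal a /\ card_le a N.

(* l = aleph^*(|N|) *)
Definition is_lindenbaum {M : structure} (l N : M) : Prop :=
  forall a : M, a ∈ l <-> ordinal a /\ card_le_star a N.

(* Cov(L, |m|, |n|); the class L of cardinals is given by the class of sets
   whose size belongs to it. A is the family i |-> A_i, i in I. *)
Definition Cov {M : structure} (L : M -> Prop) (m n : M) : Prop :=
  exists X I A : M,
    card_eq X n /\ card_eq I m /\ function_on A I /\
    (forall i Ai : M, app A i Ai -> L Ai) /\
    (forall x : M, x ∈ X -> exists i Ai : M, app A i Ai /\ x ∈ Ai).

Definition Cov_lt {M : structure} (l m n : M) : Prop :=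
  Cov (fun K : M => card_lt K l) m n.

(* Main.v *)
(* Let [X] be covered by the [A_i], [|A_i| < lam], and let [g : X -> nu] be a
   bijection.  The image [B_i] of [A_i ∩ X] in [nu] is well-ordered by [∈], so
   its Mostowski collapse is an ordinal, chosen canonically.  The collapse stays
   inside [lam], as otherwise [lam] would inject into [A_i] and be equinumerous
   with it by Cantor-Bernstein.  Sending [(b, i)] to the element of [B_i] with
   collapse [b] is a partial map of [lam * m] onto [nu].  Hence every ordinal
   injecting into [nu] is an image of [lam * m].  Lindenbaum sets exist by
   Replacement over the relations on [N]: a surjection [f] of [N] onto a
   transitive set is the Mostowski collapse of the relation [f x ∈ f y]. *)

Require Import Defs.
From Stdlib Require Import Classical PeanoNat.

(** * Definability with parameters *)

Definition rename_under (r : nat -> nat) (n : nat) : nat :=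
  match n with O => O | S k => S (r k) end.

Fixpoint rename (r : nat -> nat) (p : formula) : formula :=
  match p with
  | fMem i j => fMem (r i) (r j)
  | fEq i j => fEq (r i) (r j)
  | fNot p => fNot (rename r p)
  | fAnd p q => fAnd (rename r p) (rename r q)
  | fOr p q => fOr (rename r p) (rename r q)
  | fImp p q => fImp (rename r p) (rename r q)
  | fAll p => fAll (rename (rename_under r) p)
  | fEx p => fEx (rename (rename_under r) p)
  end.

Section Definability.

Context {M : structure}.

Lemma sat_rename (p : formula) (r : nat -> nat) (e e' : nat -> M) :
  (forall n, e' n = e (r n)) -> (sat e (rename r p) <-> sat e' p).
Proof.
  assert (scons_under : forall (r : nat -> nat) (e e' : nat -> M) x,
    (forall n, e' n = e (r n)) ->
    forall n, scons x e' n = scons x e (rename_under r n))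
    by (intros ? ? ? ? He [|n]; [reflexivity | apply He]).
  revert r e e';
    induction p as [i j|i j|p IH|p IHp q IHq|p IHp q IHq|p IHp q IHq|p IH|p IH];
    intros r e e' He; cbn;
    rewrite ?He; try rewrite (IH _ _ _ He); try rewrite (IHp _ _ _ He);
    try rewrite (IHq _ _ _ He); try reflexivity.
  - split; intros Hx x; apply (IH _ _ _ (scons_under _ _ _ x He)), Hx.
  - split; intros [x Hx]; exists x; apply (IH _ _ _ (scons_under _ _ _ x He)), Hx.
Qed.

Definition value (e : nat -> M) (t : nat + M) : M :=
  match t with inl n => e n | inr c => c end.

(* The predicate reads its variables off the environment [e]; [s] says which
   variables of [p] stand for these and which for fixed parameters. *)
Definition definable (P : (nat -> M) -> Prop) : Prop :=
  exists (p : formula) (s : nat -> nat + M),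
    forall e, sat (fun n => value e (s n)) p <-> P e.

Definition definable_class (P : M -> Prop) : Prop :=
  definable (fun e => P (e 0)).

Definition definable_relation (R : M -> M -> Prop) : Prop :=
  definable (fun e => R (e 0) (e 1)).

Definition is_term (t : (nat -> M) -> M) : Prop :=
  exists t', forall e, t e = value e t'.

Lemma is_term_variable (n : nat) : is_term (fun e => e n).
Proof. exists (inl n); reflexivity. Qed.

Lemma is_term_parameter (c : M) : is_term (fun _ => c).
Proof. exists (inr c); reflexivity. Qed.

Lemma definable_relation_terms (R : M -> M -> Prop) (t u : (nat -> M) -> M) :
  definable_relation R -> is_term t -> is_term u -> definable (fun e => R (t e) (u e)).
Proof.
  intros (p & s & Hp) [t' Ht] [u' Hu].
  exists (rename (fun n => n) p), (fun n => match s n with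
    | inl O => t'
    | inl (S _) => u'
    | inr c => inr c
    end).
  intro e; rewrite (Ht e), (Hu e).
  rewrite <- (Hp (fun n => match n with O => value e t' | S _ => value e u' end)).
  apply sat_rename; intro n; destruct (s n) as [[|k]|c]; reflexivity.
Qed.

Lemma definable_relation_mem : definable_relation mem.
Proof. exists (fMem 0 1), inl; reflexivity. Qed.

Lemma definable_relation_eq : definable_relation eq.
Proof. exists (fEq 0 1), inl; reflexivity. Qed.

Lemma definable_not (P : (nat -> M) -> Prop) :
  definable P -> definable (fun e => ~ P e).
Proof.
  intros (p & s & Hp); exists (fNot p), s; intro e; cbn; rewrite Hp; reflexivity.
Qed.

Lemma definable_common_substitution (P Q : (nat -> M) -> Prop) :
  definable P -> definable Q ->
  exists (p q : formula) (s : nat -> nat + M), forall e,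
    (sat (fun n => value e (s n)) p <-> P e) /\
    (sat (fun n => value e (s n)) q <-> Q e).
Proof.
  intros (p & s & Hp) (q & s' & Hq).
  exists (rename (fun n => 2 * n) p), (rename (fun n => S (2 * n)) q),
    (fun n => if Nat.even n then s (Nat.div2 n) else s' (Nat.div2 n)).
  intro e; rewrite <- (Hp e), <- (Hq e); split; apply sat_rename; intro n.
  - rewrite Nat.even_even, Nat.div2_double; reflexivity.
  - rewrite Nat.even_succ, Nat.odd_even, Nat.div2_succ_double; reflexivity.
Qed.

Lemma definable_and (P Q : (nat -> M) -> Prop) :
  definable P -> definable Q -> definable (fun e => P e /\ Q e).
Proof.
  intros HP HQ; destruct (definable_common_substitution P Q HP HQ) as (p & q & s & H).
  exists (fAnd p q), s; intro e; cbn; destruct (H e) as [-> ->]; reflexivity.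
Qed.

Lemma definable_or (P Q : (nat -> M) -> Prop) :
  definable P -> definable Q -> definable (fun e => P e \/ Q e).
Proof.
  intros HP HQ; destruct (definable_common_substitution P Q HP HQ) as (p & q & s & H).
  exists (fOr p q), s; intro e; cbn; destruct (H e) as [-> ->]; reflexivity.
Qed.

Lemma definable_imp (P Q : (nat -> M) -> Prop) :
  definable P -> definable Q -> definable (fun e => P e -> Q e).
Proof.
  intros HP HQ; destruct (definable_common_substitution P Q HP HQ) as (p & q & s & H).
  exists (fImp p q), s; intro e; cbn; destruct (H e) as [-> ->]; reflexivity.
Qed.

(* [s] may send several variables of [p] to the one that gets bound. *)
Lemma definable_bound_variable (P : (nat -> M) -> M -> Prop) :
  definable (fun e => P (fun n => e (S n)) (e 0)) ->
  exists (p : formula) (s : nat -> nat + M),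
    forall e x, sat (scons x (fun n => value e (s n))) p <-> P e x.
Proof.
  intros (p & s & Hp).
  exists (rename (fun n => match s n with inl O => O | _ => S n end) p),
    (fun n => match s n with inl (S k) => inl k | t => t end).
  intros e x; rewrite <- (Hp (scons x e)); apply sat_rename.
  intro n; destruct (s n) as [[|k]|c] eqn:Hs; cbn; rewrite ?Hs; reflexivity.
Qed.

Lemma definable_all (P : (nat -> M) -> M -> Prop) :
  definable (fun e => P (fun n => e (S n)) (e 0)) ->
  definable (fun e => forall x, P e x).
Proof.
  intro HP; destruct (definable_bound_variable P HP) as (p & s & Hp).
  exists (fAll p), s; intro e; split; intros H x; apply Hp, H.
Qed.

Lemma definable_ex (P : (nat -> M) -> M -> Prop) :
  definable (fun e => P (fun n => e (S n)) (e 0)) ->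
  definable (fun e => exists x, P e x).
Proof.
  intro HP; destruct (definable_bound_variable P HP) as (p & s & Hp).
  exists (fEx p), s; intro e; split; intros [x H]; exists x; apply Hp, H.
Qed.

(* The default [c] fills the environment where [p] uses no parameter. *)
Lemma definable_relation_formula (R : M -> M -> Prop) (c : M) :
  definable_relation R ->
  exists (p : formula) (e : nat -> M),
    forall x y, sat (scons x (scons y e)) p <-> R x y.
Proof.
  intros (p & s & Hp).
  exists (rename (fun n => match s n with
    | inl O => 0
    | inl (S O) => 1
    | _ => S (S n)
    end) p),
    (fun n => value (fun _ => c) (s n)).
  intros x y; rewrite <- (Hp (scons x (scons y (fun _ => c)))); apply sat_rename.
  intro n; destruct (s n) as [[|[|k]]|d] eqn:Hs; cbn; rewrite ?Hs; reflexivity.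
Qed.

End Definability.

Existing Class definable_class.
Existing Class definable_relation.

Create HintDb set_formulas.

#[local] Hint Unfold iff subset is_empty is_upair is_pair app function_on maps_to
  injection surjection card_le transitive_set well_ordered_by_mem ordinal
  definable_class definable_relation : set_formulas.

Ltac prove_definable_step :=
  cbv beta;
  lazymatch goal with
  | |- is_term _ => first [apply is_term_variable | apply is_term_parameter]
  | |- definable (fun e => ~ @?P e) => apply (definable_not P)
  | |- definable (fun e => @?P e /\ @?Q e) => apply (definable_and P Q)
  | |- definable (fun e => @?P e \/ @?Q e) => apply (definable_or P Q)
  | |- definable (fun e => @?P e -> @?Q e) => apply (definable_imp P Q)
  | |- definable (fun e => forall x, @?P e x) => apply (definable_all P)
  | |- definable (fun e => exists x, @?P e x) => apply (definable_ex P)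
  | |- definable (fun e => ?R (@?t e) (@?u e)) =>
      apply (definable_relation_terms R t u);
        [first [exact definable_relation_mem | exact definable_relation_eq | assumption] | |]
  end.

Ltac prove_definable :=
  autounfold with set_formulas; repeat prove_definable_step.

#[local] Hint Extern 1 (definable_class _) => prove_definable : typeclass_instances.
#[local] Hint Extern 1 (definable_relation _) => prove_definable : typeclass_instances.

#[local] Arguments zf_extensionality {M} _.
#[local] Arguments zf_foundation {M} _.
#[local] Arguments zf_pairing {M} _.
#[local] Arguments zf_union {M} _.
#[local] Arguments zf_power {M} _.
#[local] Arguments zf_separation {M} _.
#[local] Arguments zf_replacement {M} _.

(** * Sets and functions *)

Section ZFModel.

Context {M : structure} (HZF : ZF M).

Lemma separation (P : M -> Prop) {HP : definable_class P} (a : M) :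
  exists b, forall x, x ∈ b <-> x ∈ a /\ P x.
Proof.
  destruct (definable_relation_formula (fun x _ => P x) a HP) as (p & e & Hp).
  destruct (zf_separation HZF p (scons a e) a) as [b Hb].
  exists b; intro x; rewrite Hb, Hp; reflexivity.
Qed.

Lemma replacement (R : M -> M -> Prop) {HR : definable_relation R} (a : M) :
  (forall x y y', x ∈ a -> R x y -> R x y' -> y = y') ->
  exists b, forall y, y ∈ b <-> exists x, x ∈ a /\ R x y.
Proof.
  intro R_functional; destruct (definable_relation_formula R a HR) as (p & e & Hp).
  destruct (zf_replacement HZF p e a) as [b Hb].
  - intros x y y'; rewrite !Hp; apply R_functional.
  - exists b; intro y; rewrite Hb; split; intros (x & Hx & Hxy); exists x;
      (split; [exact Hx | apply Hp, Hxy]).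
Qed.

Lemma minimal_element (P : M -> Prop) {HP : definable_class P} (a x : M) :
  x ∈ a -> P x ->
  exists y, y ∈ a /\ P y /\ forall z, z ∈ a -> z ∈ y -> ~ P z.
Proof.
  intros Hx Px; destruct (separation P a) as [b Hb].
  destruct (zf_foundation HZF b) as (y & Hy & y_min).
  - intro b_empty; apply (b_empty x), Hb; auto.
  - apply Hb in Hy as [Hya Py]; exists y; split; [exact Hya | split; [exact Py |]].
    intros z Hza Hzy Pz; apply (y_min z); [apply Hb; auto | exact Hzy].
Qed.

Lemma mem_irrefl (x : M) : ~ x ∈ x.
Proof.
  destruct (zf_pairing HZF x x) as [s Hs].
  destruct (minimal_element (fun t => t = x) s x) as (y & _ & -> & x_min);
    [apply Hs; auto | reflexivity |].
  intro Hx; apply (x_min x); [apply Hs; auto | exact Hx | reflexivity].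
Qed.

Lemma empty_set_exists (a : M) : exists o : M, is_empty o.
Proof.
  destruct (separation (fun x => ~ x = x) a) as [o Ho].
  exists o; intros x Hx; apply Ho in Hx; tauto.
Qed.

Lemma binary_union_exists (X Y : M) :
  exists U, forall z, z ∈ U <-> z ∈ X \/ z ∈ Y.
Proof.
  destruct (zf_pairing HZF X Y) as [p Hp].
  destruct (zf_union HZF p) as [U HU].
  exists U; intro z; rewrite HU; split.
  - intros (y & Hy & Hz); apply Hp in Hy as [->| ->]; auto.
  - intros [Hz|Hz]; [exists X | exists Y]; rewrite Hp; auto.
Qed.

Lemma pair_exists (x y : M) : exists z, is_pair z x y.
Proof.
  destruct (zf_pairing HZF x x) as [s Hs].
  destruct (zf_pairing HZF x y) as [d Hd].
  destruct (zf_pairing HZF s d) as [z Hz].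
  exists z; intro u; rewrite Hz; split.
  - intros [->| ->]; auto.
  - intros [Hu|Hu]; [left | right]; apply (zf_extensionality HZF); intro t;
      [rewrite Hs | rewrite Hd]; apply Hu.
Qed.

Lemma pair_fst_inj (z x y x' y' : M) : is_pair z x y -> is_pair z x' y' -> x = x'.
Proof.
  intros Hz Hz'; destruct (zf_pairing HZF x x) as [s Hs].
  assert (Hsz : s ∈ z) by (apply Hz; left; exact Hs).
  assert (Hx' : x' ∈ s) by (apply Hz' in Hsz as [Hsz|Hsz]; apply Hsz; auto).
  apply Hs in Hx' as [Hx'|Hx']; auto.
Qed.

Lemma pair_inj (z x y x' y' : M) :
  is_pair z x y -> is_pair z x' y' -> x = x' /\ y = y'.
Proof.
  assert (snd_mem : forall x y x' y' : M,
    is_pair z x y -> is_pair z x' y' -> y = x' \/ y = y').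
  { clear x y x' y'; intros x y x' y' Hz Hz'.
    destruct (zf_pairing HZF x y) as [d Hd].
    assert (Hdz : d ∈ z) by (apply Hz; right; exact Hd).
    assert (Hy : y ∈ d) by (apply Hd; auto).
    apply Hz' in Hdz as [Hdz|Hdz]; apply Hdz in Hy; tauto. }
  intros Hz Hz'; pose proof (pair_fst_inj z x y x' y' Hz Hz') as Hx; split; [exact Hx |].
  destruct (snd_mem _ _ _ _ Hz Hz'), (snd_mem _ _ _ _ Hz' Hz); congruence.
Qed.

Lemma product_exists (X Y : M) : exists P, is_product P X Y.
Proof.
  destruct (binary_union_exists X Y) as [U HU].
  destruct (zf_power HZF U) as [PU HPU].
  destruct (zf_power HZF PU) as [PPU HPPU].
  destruct (separation (fun z => exists x y, x ∈ X /\ y ∈ Y /\ is_pair z x y) PPU)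
    as [P HP].
  exists P; intro z; rewrite HP; split; [tauto |].
  intros (x & y & Hx & Hy & Hz); split; [| exists x, y; auto].
  apply HPPU; intros u Hu; apply HPU; intros t Ht; apply HU.
  apply Hz in Hu as [Hu|Hu]; apply Hu in Ht as [->| ->]; auto.
Qed.

Lemma relation_exists (R : M -> M -> Prop) {HR : definable_relation R} (X Y : M) :
  exists f,
    (forall x y, app f x y <-> x ∈ X /\ y ∈ Y /\ R x y) /\
    (forall z, z ∈ f -> exists x y, x ∈ X /\ y ∈ Y /\ is_pair z x y).
Proof.
  destruct (product_exists X Y) as [P HP].
  destruct (separation (fun z => exists x y, is_pair z x y /\ R x y) P) as [f Hf].
  exists f; split.
  - intros x y; split.
    + intros (z & Hz & Hzf); apply Hf in Hzf as (HzP & x1 & y1 & Hz1 & Hxy).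
      apply HP in HzP as (x2 & y2 & Hx2 & Hy2 & Hz2).
      destruct (pair_inj _ _ _ _ _ Hz Hz1) as [-> ->].
      destruct (pair_inj _ _ _ _ _ Hz1 Hz2) as [-> ->]; auto.
    + intros (Hx & Hy & Hxy); destruct (pair_exists x y) as [z Hz].
      exists z; split; [exact Hz |]; apply Hf; split.
      * apply HP; exists x, y; auto.
      * exists x, y; auto.
  - intros z Hz; apply Hf in Hz as [Hz _]; apply HP, Hz.
Qed.

Lemma function_exists (R : M -> M -> Prop) {HR : definable_relation R} (X : M) :
  (forall x, x ∈ X -> exists y, R x y) ->
  (forall x y y', x ∈ X -> R x y -> R x y' -> y = y') ->
  exists f, function_on f X /\ forall x y, app f x y <-> x ∈ X /\ R x y.
Proof.
  intros R_total R_functional.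
  destruct (replacement R X R_functional) as [Y HY].
  destruct (relation_exists R X Y) as (f & Hf & f_pairs).
  assert (f_app : forall x y, app f x y <-> x ∈ X /\ R x y).
  { intros x y; rewrite Hf, HY; split; [tauto |].
    intros [Hx Hxy]; split; [exact Hx | split; [eauto | exact Hxy]]. }
  exists f; split; [| exact f_app]; split; [| split].
  - intros z Hz; destruct (f_pairs z Hz) as (x & y & Hx & _ & Hxy); eauto.
  - intros x Hx; destruct (R_total x Hx) as [y Hy]; exists y; apply f_app; auto.
  - intros x y y' Hy Hy'; apply f_app in Hy as [Hx Hy]; apply f_app in Hy' as [_ Hy'].
    eauto.
Qed.

Lemma app_dom (f X x y : M) : function_on f X -> app f x y -> x ∈ X.
Proof.
  intros [f_pairs _] (z & Hz & Hzf); apply f_pairs in Hzf as (x' & y' & Hx & Hz').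
  destruct (pair_inj _ _ _ _ _ Hz Hz') as [-> _]; exact Hx.
Qed.

Lemma app_total (f X x : M) : function_on f X -> x ∈ X -> exists y, app f x y.
Proof. intros (_ & f_total & _); apply f_total. Qed.

Lemma app_functional (f X x y y' : M) :
  function_on f X -> app f x y -> app f x y' -> y = y'.
Proof. intros (_ & _ & f_functional); apply f_functional. Qed.

Lemma range_exists (f X : M) : function_on f X -> exists V, surjection f X V.
Proof.
  intro Hf; destruct (replacement (app f) X) as [V HV].
  - intros x y y' _; apply (app_functional f X); exact Hf.
  - exists V; split; [split; [exact Hf |] |].
    + intros x y Hxy; apply HV; exists x.
      split; [exact (app_dom f X x y Hf Hxy) | exact Hxy].
    + intros y Hy; apply HV in Hy as (x & _ & Hxy); eauto.
Qed.

(** * Comparing cardinals *)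

Definition total_on (R : M -> M -> Prop) (X Y : M) : Prop :=
  forall x, x ∈ X -> exists y, y ∈ Y /\ R x y.

Definition functional_on (R : M -> M -> Prop) (X Y : M) : Prop :=
  forall x y y', x ∈ X -> y ∈ Y -> y' ∈ Y -> R x y -> R x y' -> y = y'.

Definition converse (R : M -> M -> Prop) (y x : M) : Prop := R x y.

Hint Unfold converse : set_formulas.

Lemma maps_to_total (f X Y : M) : maps_to f X Y -> total_on (app f) X Y.
Proof.
  intros [Hf f_range] x Hx; destruct (app_total f X x Hf Hx) as [y Hy]; eauto.
Qed.

Lemma maps_to_exists (R : M -> M -> Prop) {HR : definable_relation R} (X Y : M) :
  total_on R X Y -> functional_on R X Y ->
  exists f, maps_to f X Y /\ forall x y, app f x y <-> x ∈ X /\ y ∈ Y /\ R x y.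
Proof.
  intros R_total R_functional.
  destruct (function_exists (fun x y => y ∈ Y /\ R x y) X R_total) as (f & Hf & f_app).
  - intros x y y' Hx [Hy Hxy] [Hy' Hxy']; exact (R_functional x y y' Hx Hy Hy' Hxy Hxy').
  - exists f; split; [split; [exact Hf |] | exact f_app].
    intros x y Hxy; apply f_app in Hxy; tauto.
Qed.

Lemma injection_exists (R : M -> M -> Prop) {HR : definable_relation R} (X Y : M) :
  total_on R X Y -> functional_on R X Y -> functional_on (converse R) Y X ->
  exists f, injection f X Y /\ forall x y, app f x y <-> x ∈ X /\ y ∈ Y /\ R x y.
Proof.
  intros R_total R_functional R_injective.
  destruct (maps_to_exists R X Y R_total R_functional) as (f & Hf & f_app).
  exists f; split; [split; [exact Hf |] | exact f_app].
  intros x x' y Hy Hy'; apply f_app in Hy as (Hx & Hy & Hxy).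
  apply f_app in Hy' as (Hx' & _ & Hxy').
  exact (R_injective y x x' Hy Hx Hx' Hxy Hxy').
Qed.

Lemma card_le_of_relation (R : M -> M -> Prop) {HR : definable_relation R} (X Y : M) :
  total_on R X Y -> functional_on R X Y -> functional_on (converse R) Y X -> card_le X Y.
Proof.
  intros R_total R_functional R_injective; right.
  destruct (injection_exists R X Y R_total R_functional R_injective) as (f & Hf & _); eauto.
Qed.

Lemma card_eq_of_relation (R : M -> M -> Prop) {HR : definable_relation R} (X Y : M) :
  total_on R X Y -> functional_on R X Y ->
  total_on (converse R) Y X -> functional_on (converse R) Y X -> card_eq X Y.
Proof.
  intros R_total R_functional R_surjective R_injective.
  destruct (injection_exists R X Y R_total R_functional R_injective) as (f & Hf & f_app).
  exists f; split; [exact Hf | split; [apply Hf |]].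
  intros y Hy; destruct (R_surjective y Hy) as (x & Hx & Hxy).
  exists x; apply f_app; auto.
Qed.

Lemma card_le_star_of_relation (R : M -> M -> Prop) {HR : definable_relation R} (X Y : M) :
  functional_on R X Y -> total_on (converse R) Y X -> card_le_star Y X.
Proof.
  intros R_functional R_surjective.
  destruct (classic (is_empty Y)) as [Y_empty|Y_inhabited]; [left; exact Y_empty | right].
  apply not_all_ex_not in Y_inhabited as [y0 Hy0]; apply NNPP in Hy0.
  destruct (maps_to_exists (fun x y => R x y \/ (y = y0 /\ ~ exists u, u ∈ Y /\ R x u)) X Y)
    as (f & Hf & f_app).
  - intros x Hx.
    destruct (classic (exists u, u ∈ Y /\ R x u)) as [(u & Hu & Hxu)|Hno]; eauto.
  - intros x y y' Hx Hy Hy' [Hxy|[-> Hno]] [Hxy'|[-> Hno']]; eauto.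
    + destruct Hno'; eauto.
    + destruct Hno; eauto.
  - exists f; split; [exact Hf |]; intros y Hy.
    destruct (R_surjective y Hy) as (x & Hx & Hxy); exists x; apply f_app; auto.
Qed.

Lemma card_le_subset (X Y : M) : subset X Y -> card_le X Y.
Proof.
  intro HXY; apply (card_le_of_relation eq).
  - intros x Hx; eauto.
  - intros x y y' _ _ _; congruence.
  - intros y x x' _ _ _; unfold converse; congruence.
Qed.

Lemma card_le_injection (X Y : M) : card_le X Y -> exists f, injection f X Y.
Proof.
  intros [X_empty|Hf]; [| exact Hf].
  destruct (injection_exists eq X Y) as (f & Hf & _); [| | | exists f; exact Hf].
  - intros x Hx; destruct (X_empty x Hx).
  - intros x y y' Hx; destruct (X_empty x Hx).
  - intros y x x' _ Hx; destruct (X_empty x Hx).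
Qed.

Lemma card_le_trans (X Y Z : M) : card_le X Y -> card_le Y Z -> card_le X Z.
Proof.
  intros HXY HYZ.
  destruct (card_le_injection X Y HXY) as [f [f_maps f_inj]].
  destruct (card_le_injection Y Z HYZ) as [g [g_maps g_inj]].
  apply (card_le_of_relation (fun x z => exists y, app f x y /\ app g y z)).
  - intros x Hx; destruct (maps_to_total f X Y f_maps x Hx) as (y & Hy & Hxy).
    destruct (maps_to_total g Y Z g_maps y Hy) as (z & Hz & Hyz); eauto.
  - intros x z z' _ _ _ (y & Hy & Hz) (y' & Hy' & Hz').
    rewrite (app_functional f X x y' y (proj1 f_maps) Hy' Hy) in Hz'.
    exact (app_functional g Y y z z' (proj1 g_maps) Hz Hz').
  - intros z x x' _ _ _ (y & Hy & Hz) (y' & Hy' & Hz').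
    rewrite (g_inj y' y z Hz' Hz) in Hy'; eauto.
Qed.

Lemma card_le_star_refl (X : M) : card_le_star X X.
Proof.
  apply (card_le_star_of_relation eq).
  - intros x y y' _ _ _; congruence.
  - intros x Hx; exists x; split; [exact Hx | reflexivity].
Qed.

Lemma card_le_le_star_trans (X Y Z : M) :
  card_le X Y -> card_le_star Y Z -> card_le_star X Z.
Proof.
  intros HXY HYZ; destruct (card_le_injection X Y HXY) as [f [f_maps f_inj]].
  pose proof (maps_to_total f X Y f_maps) as f_total.
  destruct HYZ as [Y_empty|[g [[Hg _] g_surj]]].
  - left; intros x Hx; destruct (f_total x Hx) as (y & Hy & _); exact (Y_empty y Hy).
  - apply (card_le_star_of_relation (fun z x => exists y, app f x y /\ app g z y)).
    + intros z x x' _ _ _ (y & Hxy & Hzy) (y' & Hxy' & Hzy').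
      rewrite (app_functional g Z z y' y Hg Hzy' Hzy) in Hxy'; eauto.
    + intros x Hx; destruct (f_total x Hx) as (y & Hy & Hxy).
      destruct (g_surj y Hy) as [z Hzy]; exists z.
      split; [exact (app_dom g Z z y Hg Hzy) | exists y; auto].
Qed.

Lemma least_fixed_point (Phi : M -> M -> Prop) {HPhi : definable_relation Phi} (X : M) :
  (forall Z Z' x, subset Z Z' -> Phi Z x -> Phi Z' x) ->
  exists D, forall x, x ∈ D <-> x ∈ X /\ Phi D x.
Proof.
  intro Phi_monotone.
  destruct (separation
    (fun x => forall Z, (forall t, t ∈ X -> Phi Z t -> t ∈ Z) -> x ∈ Z) X) as [D HD].
  assert (Phi_D : forall x, x ∈ X -> Phi D x -> x ∈ D).
  { intros x Hx Dx; apply HD; split; [exact Hx |]; intros Z Z_closed.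
    apply Z_closed; [exact Hx |]; apply (Phi_monotone D Z); [| exact Dx].
    intros t Ht; apply HD in Ht as [_ Ht]; auto. }
  exists D; intro x; split; [| intros [Hx Dx]; auto].
  intro Hx; destruct (separation (Phi D) X) as [Z HZ].
  apply HZ, HD; [exact Hx |]; intros t Ht Zt.
  apply HZ; split; [exact Ht |]; apply (Phi_monotone Z D); [| exact Zt].
  intros u Hu; apply HZ in Hu as [HuX Hu]; auto.
Qed.

(* [D = X \ g[Y \ f[D]]], where [g] is a function on [Y] *)
Lemma banach_decomposition (f g X : M) :
  exists D, subset D X /\
    (forall x y, x ∈ D -> app g y x -> exists s, s ∈ D /\ app f s y) /\
    (forall x, x ∈ X -> ~ x ∈ D ->
      exists y, app g y x /\ ~ exists s, s ∈ D /\ app f s y).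
Proof.
  destruct (least_fixed_point
    (fun D x => forall y, app g y x -> exists s, s ∈ D /\ app f s y) X) as [D HD].
  { intros Z Z' x HZ Hx y Hy; destruct (Hx y Hy) as (s & Hs & Hsy); eauto. }
  exists D; split; [intros x Hx; apply HD, Hx | split].
  - intros x y Hx; apply HD in Hx as [_ Hx]; apply Hx.
  - intros x Hx HxD; apply NNPP; intro Hno; apply HxD, HD; split; [exact Hx |].
    intros y Hy; apply NNPP; intro Hs; apply Hno; eauto.
Qed.

Lemma card_le_antisym (X Y : M) : card_le X Y -> card_le Y X -> card_eq X Y.
Proof.
  intros HXY HYX.
  destruct (card_le_injection X Y HXY) as [f [f_maps f_inj]].
  destruct (card_le_injection Y X HYX) as [g [g_maps g_inj]].
  pose proof (proj1 f_maps) as Hf; pose proof (proj1 g_maps) as Hg.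
  destruct (banach_decomposition f g X) as (D & D_subset & preimage_inside & preimage_outside).
  assert (branches_disjoint : forall x x' y,
    x ∈ D -> x' ∈ X -> ~ x' ∈ D -> app f x y -> app g y x' -> False).
  { intros x x' y Hx Hx' Hx'D Hxy Hyx'.
    destruct (preimage_outside x' Hx' Hx'D) as (y' & Hy' & Hno).
    apply Hno; exists x; rewrite (g_inj y' y x' Hy' Hyx'); auto. }
  apply (card_eq_of_relation
    (fun x y => (x ∈ D /\ app f x y) \/ (~ x ∈ D /\ app g y x))).
  - intros x Hx; destruct (classic (x ∈ D)) as [HxD|HxD].
    + destruct (maps_to_total f X Y f_maps x Hx) as (y & Hy & Hxy); eauto.
    + destruct (preimage_outside x Hx HxD) as (y & Hyx & _).
      exists y; split; [exact (app_dom g Y y x Hg Hyx) | auto].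
  - intros x y y' _ _ _ [[HxD Hy]|[HxD Hy]] [[HxD' Hy']|[HxD' Hy']]; try tauto.
    + exact (app_functional f X x y y' Hf Hy Hy').
    + exact (g_inj y y' x Hy Hy').
  - intros y Hy; destruct (maps_to_total g Y X g_maps y Hy) as (x & Hx & Hyx).
    destruct (classic (x ∈ D)) as [HxD|HxD]; [| exists x; unfold converse; auto].
    destruct (preimage_inside x y HxD Hyx) as (s & Hs & Hsy).
    exists s; unfold converse; auto.
  - intros y x x' _ Hx Hx' [[HxD Hxy]|[HxD Hxy]] [[HxD' Hxy']|[HxD' Hxy']].
    + exact (f_inj x x' y Hxy Hxy').
    + destruct (branches_disjoint x x' y); auto.
    + destruct (branches_disjoint x' x y); auto.
    + exact (app_functional g Y y x x' Hg Hxy Hxy').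
Qed.

Lemma card_lt_not_ge (X Y : M) : card_lt X Y -> ~ card_le Y X.
Proof. intros [HXY HXY_neq] HYX; exact (HXY_neq (card_le_antisym X Y HXY HYX)). Qed.

(** * The Mostowski collapse *)

Definition well_founded_on (R : M -> M -> Prop) (X : M) : Prop :=
  forall s, subset s X -> ~ is_empty s ->
    exists y, y ∈ s /\ forall x, x ∈ s -> ~ R x y.

Definition initial_segment (R : M -> M -> Prop) (D X : M) : Prop :=
  subset D X /\ forall x y, x ∈ X -> y ∈ D -> R x y -> x ∈ D.

Definition collapse (R : M -> M -> Prop) (X f : M) : Prop :=
  function_on f X /\
  forall y v, app f y v -> forall u, u ∈ v <-> exists x, R x y /\ app f x u.

Hint Unfold initial_segment collapse : set_formulas.

Lemma mem_well_founded_on (X : M) : well_founded_on mem X.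
Proof. intros s _; apply (zf_foundation HZF). Qed.

Lemma well_founded_on_induction (R : M -> M -> Prop) (X D : M) :
  well_founded_on R X ->
  (forall y, y ∈ X -> (forall x, x ∈ X -> R x y -> x ∈ D) -> y ∈ D) ->
  subset X D.
Proof.
  intros R_wf D_closed; apply NNPP; intro D_proper.
  destruct (separation (fun y => ~ y ∈ D) X) as [s Hs].
  destruct (R_wf s) as (y & Hy & y_min).
  - intros y Hy; apply Hs in Hy; tauto.
  - intro s_empty; apply D_proper; intros y Hy; apply NNPP; intro HyD.
    apply (s_empty y), Hs; auto.
  - apply Hs in Hy as [Hy HyD]; apply HyD, (D_closed y Hy); intros x Hx Hxy.
    apply NNPP; intro HxD; apply (y_min x); [apply Hs; auto | exact Hxy].
Qed.

Lemma collapse_well_founded (R : M -> M -> Prop) (X f : M) :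
  collapse R X f -> well_founded_on R X.
Proof.
  intros [Hf f_spec] s s_subset s_inhabited.
  destruct (range_exists f X Hf) as (V & [_ f_range] & _).
  apply not_all_ex_not in s_inhabited as [x0 Hx0]; apply NNPP in Hx0.
  destruct (app_total f X x0 Hf (s_subset x0 Hx0)) as [v0 Hv0].
  destruct (minimal_element (fun v => exists x, x ∈ s /\ app f x v) V v0)
    as (v & Hv & (y & Hy & Hyv) & v_min); [exact (f_range x0 v0 Hv0) | eauto |].
  exists y; split; [exact Hy |]; intros x Hx Hxy.
  destruct (app_total f X x Hf (s_subset x Hx)) as [u Hu].
  apply (v_min u); [exact (f_range x u Hu) | apply (f_spec y v Hyv) | ]; eauto.
Qed.

Lemma collapse_unique (R : M -> M -> Prop) (X D D' f f' z v v' : M) :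
  initial_segment R D X -> initial_segment R D' X ->
  collapse R D f -> collapse R D' f' -> app f z v -> app f' z v' -> v = v'.
Proof.
  intros [D_sub D_init] [D'_sub D'_init] Hcf Hcf'.
  pose proof (collapse_well_founded R D f Hcf) as R_wf.
  destruct Hcf as [Hf f_spec], Hcf' as [Hf' f'_spec].
  destruct (separation (fun y => forall v v', app f y v -> app f' y v' -> v = v') D)
    as [E HE].
  assert (f_eq_f' : subset D E).
  { apply (well_founded_on_induction R D E R_wf); intros y Hy eq_below.
    apply HE; split; [exact Hy |]; intros w w' Hw Hw'.
    assert (Hy' : y ∈ D') by exact (app_dom f' D' y w' Hf' Hw').
    apply (zf_extensionality HZF); intro u.
    rewrite (f_spec y w Hw u), (f'_spec y w' Hw' u).
    split; intros (x & Hxy & Hxu); exists x; (split; [exact Hxy |]).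
    - pose proof (app_dom f D x u Hf Hxu) as Hx.
      destruct (app_total f' D' x Hf' (D'_init x y (D_sub x Hx) Hy' Hxy)) as [u' Hu'].
      destruct (proj1 (HE x) (eq_below x Hx Hxy)) as [_ eq_at_x].
      rewrite (eq_at_x u u' Hxu Hu'); exact Hu'.
    - pose proof (D_init x y (D'_sub x (app_dom f' D' x u Hf' Hxu)) Hy Hxy) as Hx.
      destruct (app_total f D x Hf Hx) as [u' Hu'].
      destruct (proj1 (HE x) (eq_below x Hx Hxy)) as [_ eq_at_x].
      rewrite <- (eq_at_x u' u Hu' Hxu); exact Hu'. }
  intros Hv Hv'; destruct (proj1 (HE z) (f_eq_f' z (app_dom f D z v Hf Hv))) as [_ eq_at_z].
  exact (eq_at_z v v' Hv Hv').
Qed.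

Lemma initial_segment_refl (R : M -> M -> Prop) (X : M) : initial_segment R X X.
Proof. split; [intros x Hx | intros x y Hx _ _]; exact Hx. Qed.

Definition collapse_value (R : M -> M -> Prop) (X y v : M) : Prop :=
  exists D f, initial_segment R D X /\ collapse R D f /\ app f y v.

Hint Unfold collapse_value : set_formulas.

Lemma collapse_value_unique (R : M -> M -> Prop) (X y v v' : M) :
  collapse_value R X y v -> collapse_value R X y v' -> v = v'.
Proof.
  intros (D & f & HD & Hf & Hv) (D' & f' & HD' & Hf' & Hv').
  exact (collapse_unique R X D D' f f' y v v' HD HD' Hf Hf' Hv Hv').
Qed.

Lemma collapse_value_predecessor (R : M -> M -> Prop) (X x y v : M) :
  collapse_value R X y v -> x ∈ X -> R x y -> exists u, collapse_value R X x u.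
Proof.
  intros (D & f & HD & Hcf & Hv) Hx Hxy; pose proof (proj1 Hcf) as Hf.
  destruct (app_total f D x Hf) as [u Hu].
  - exact (proj2 HD x y Hx (app_dom f D y v Hf Hv) Hxy).
  - exists u, D, f; auto.
Qed.

Lemma mem_collapse_value (R : M -> M -> Prop) (X y v : M) :
  collapse_value R X y v ->
  forall u, u ∈ v <-> exists x, x ∈ X /\ R x y /\ collapse_value R X x u.
Proof.
  intros (D & f & HD & Hcf & Hv) u; pose proof (proj1 Hcf) as Hf.
  rewrite (proj2 Hcf y v Hv u); split.
  - intros (x & Hxy & Hu); exists x; split; [| split; [exact Hxy |]].
    + exact (proj1 HD x (app_dom f D x u Hf Hu)).
    + exists D, f; auto.
  - intros (x & Hx & Hxy & Hu); exists x; split; [exact Hxy |].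
    destruct (app_total f D x Hf) as [u' Hu'].
    + exact (proj2 HD x y Hx (app_dom f D y v Hf Hv) Hxy).
    + rewrite (collapse_value_unique R X x u u' Hu); [exact Hu' | exists D, f; auto].
Qed.

(* [D] consists of the [y] all of whose predecessors have a value, and [f] sends
   [y] to the set of these values: [D] is an initial segment on which [f] is a
   collapse, hence it contains with all predecessors of [y] also [y]. *)
Lemma collapse_exists (R : M -> M -> Prop) {HR : definable_relation R} (X : M) :
  well_founded_on R X -> exists f, collapse R X f.
Proof.
  intro R_wf.
  destruct (separation (fun y => forall x, x ∈ X -> R x y ->
    exists u, collapse_value R X x u) X) as [D HD].
  destruct (function_exists (fun y v => forall u, u ∈ v <->
    exists x, x ∈ X /\ R x y /\ collapse_value R X x u) D) as (f & Hf & f_app).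
  { intros y _; destruct (replacement (fun x u => R x y /\ collapse_value R X x u) X)
      as [v Hv]; [| exists v; exact Hv].
    intros x u u' _ [_ Hu] [_ Hu']; exact (collapse_value_unique R X x u u' Hu Hu'). }
  { intros y v v' _ Hv Hv'; apply (zf_extensionality HZF); intro u.
    rewrite Hv, Hv'; reflexivity. }
  assert (app_of_value : forall x u, x ∈ X -> collapse_value R X x u -> app f x u).
  { intros x u Hx Hu; apply f_app; split; [| exact (mem_collapse_value R X x u Hu)].
    apply HD; split; [exact Hx |]; intros w Hw Hwx.
    exact (collapse_value_predecessor R X w x u Hu Hw Hwx). }
  assert (D_initial : initial_segment R D X).
  { split; [intros x Hx; apply HD, Hx |]; intros x y Hx Hy Hxy.
    apply HD in Hy as [_ Hy]; destruct (Hy x Hx Hxy) as [u Hu].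
    exact (app_dom f D x u Hf (app_of_value x u Hx Hu)). }
  assert (f_collapse : collapse R D f).
  { split; [exact Hf |]; intros y v Hv u; apply f_app in Hv as [Hy Hv]; rewrite Hv.
    split; [intros (x & Hx & Hxy & Hu); exists x; auto |]; intros (x & Hxy & Hu).
    pose proof (proj1 D_initial x (app_dom f D x u Hf Hu)) as Hx.
    exists x; split; [exact Hx | split; [exact Hxy |]].
    apply HD in Hy as [_ Hy]; destruct (Hy x Hx Hxy) as [u' Hu'].
    rewrite (app_functional f D x u u' Hf Hu (app_of_value x u' Hx Hu')); exact Hu'. }
  assert (D_full : subset X D).
  { apply (well_founded_on_induction R X D R_wf); intros y Hy Hbelow.
    apply HD; split; [exact Hy |]; intros x Hx Hxy.
    destruct (app_total f D x Hf (Hbelow x Hx Hxy)) as [u Hu]; exists u, D, f; auto. }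
  exists f; replace X with D; [exact f_collapse |].
  apply (zf_extensionality HZF); intro y; split; [apply (proj1 D_initial) | apply D_full].
Qed.

Lemma collapse_transitive (R : M -> M -> Prop) (X f V : M) :
  collapse R X f -> surjection f X V -> transitive_set V.
Proof.
  intros [_ f_spec] [[_ f_range] f_surj] v Hv u Hu.
  destruct (f_surj v Hv) as [y Hy]; destruct (proj1 (f_spec y v Hy u) Hu) as (x & _ & Hx).
  exact (f_range x u Hx).
Qed.

Lemma surjection_collapse (R : M -> M -> Prop) (X f V : M) :
  transitive_set V -> surjection f X V ->
  (forall x y u v, app f x u -> app f y v -> (R x y <-> u ∈ v)) ->
  collapse R X f.
Proof.
  intros V_trans [[Hf f_range] f_surj] R_iff; split; [exact Hf |].
  intros y v Hv u; split.
  - intro Hu; destruct (f_surj u (V_trans v (f_range y v Hv) u Hu)) as [x Hx].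
    exists x; split; [apply (R_iff x y u v) |]; assumption.
  - intros (x & Hxy & Hx); apply (R_iff x y u v); assumption.
Qed.

Lemma collapse_app (R : M -> M -> Prop) (X f f' x u : M) :
  collapse R X f -> collapse R X f' -> app f x u -> app f' x u.
Proof.
  intros Hcf Hcf' Hu; pose proof (initial_segment_refl R X) as HX.
  destruct (app_total f' X x (proj1 Hcf') (app_dom f X x u (proj1 Hcf) Hu)) as [u' Hu'].
  rewrite (collapse_unique R X X X f f' x u u' HX HX Hcf Hcf' Hu Hu'); exact Hu'.
Qed.

Lemma collapse_range_subset (R : M -> M -> Prop) (X f f' V V' : M) :
  collapse R X f -> collapse R X f' -> surjection f X V -> surjection f' X V' ->
  subset V V'.
Proof.
  intros Hcf Hcf' [_ f_surj] [[_ f'_range] _] u Hu; destruct (f_surj u Hu) as [x Hx].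
  exact (f'_range x u (collapse_app R X f f' x u Hcf Hcf' Hx)).
Qed.

Lemma collapse_range_unique (R : M -> M -> Prop) (X f f' V V' : M) :
  collapse R X f -> collapse R X f' -> surjection f X V -> surjection f' X V' -> V = V'.
Proof.
  intros Hcf Hcf' HV HV'; apply (zf_extensionality HZF); intro u; split.
  - exact (collapse_range_subset R X f f' V V' Hcf Hcf' HV HV' u).
  - exact (collapse_range_subset R X f' f V' V Hcf' Hcf HV' HV u).
Qed.

(** * Ordinals *)

Definition trichotomous (X : M) : Prop :=
  forall x y, x ∈ X -> y ∈ X -> x ∈ y \/ x = y \/ y ∈ x.

Lemma ordinal_trichotomous (a : M) : ordinal a -> trichotomous a.
Proof. intros (_ & _ & _ & a_tri & _); exact a_tri. Qed.

Lemma trichotomous_subset (X Y : M) : subset X Y -> trichotomous Y -> trichotomous X.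
Proof. intros HXY Y_tri x y Hx Hy; apply Y_tri; apply HXY; assumption. Qed.

Lemma ordinal_of_trichotomous (a : M) : transitive_set a -> trichotomous a -> ordinal a.
Proof.
  intros a_trans a_tri; split; [exact a_trans |].
  split; [intros x _; apply mem_irrefl |]; split; [| split; [exact a_tri |]].
  - intros x y z Hx Hy Hz Hxy Hyz.
    destruct (minimal_element (fun t => t = x \/ t = y \/ t = z) a x)
      as (t & _ & [->|[->| ->]] & t_min); auto.
    + destruct (a_tri x z Hx Hz) as [Hxz|[->|Hzx]]; [exact Hxz | |].
      * destruct (t_min y Hy Hyz); auto.
      * destruct (t_min z Hz Hzx); auto.
    + destruct (t_min x Hx Hxy); auto.
    + destruct (t_min y Hy Hyz); auto.
  - intros s s_subset s_inhabited.
    destruct (zf_foundation HZF s s_inhabited) as (x & Hx & x_min).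
    exists x; split; [exact Hx |]; intros y Hy.
    destruct (a_tri x y (s_subset x Hx) (s_subset y Hy)) as [Hxy|[Hxy|Hyx]]; auto.
    destruct (x_min y Hy Hyx).
Qed.

Lemma ordinal_empty (a : M) : is_empty a -> ordinal a.
Proof.
  intro a_empty; apply ordinal_of_trichotomous.
  - intros x Hx; destruct (a_empty x Hx).
  - intros x y Hx; destruct (a_empty x Hx).
Qed.

Lemma transitive_subset_ordinal (V a : M) :
  ordinal a -> subset V a -> transitive_set V -> V = a \/ V ∈ a.
Proof.
  intros Ha V_subset V_trans; pose proof (ordinal_trichotomous a Ha) as a_tri.
  destruct (classic (subset a V)) as [a_subset|a_not_subset].
  - left; apply (zf_extensionality HZF); intro z; split; auto.
  - right; apply not_all_ex_not in a_not_subset as [x Hx].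
    apply imply_to_and in Hx as [Hxa HxV].
    destruct (minimal_element (fun t => ~ t ∈ V) a x)
      as (t & Hta & HtV & t_min); [exact Hxa | exact HxV |].
    replace V with t; [exact Hta |].
    apply (zf_extensionality HZF); intro u; split; intro Hu.
    + apply NNPP; exact (t_min u (proj1 Ha t Hta u Hu) Hu).
    + destruct (a_tri u t (V_subset u Hu) Hta) as [Hut|[->|Htu]]; [exact Hut | |].
      * contradiction.
      * destruct (HtV (V_trans u Hu t Htu)).
Qed.

Lemma ordinal_subset_or_mem (a b : M) : ordinal a -> ordinal b -> subset a b \/ b ∈ a.
Proof.
  intros Ha Hb; destruct (separation (fun x => x ∈ b) a) as [c Hc].
  assert (c_trans : transitive_set c).
  { intros x Hx y Hy; apply Hc in Hx as [Hxa Hxb]; apply Hc; split.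
    - exact (proj1 Ha x Hxa y Hy).
    - exact (proj1 Hb x Hxb y Hy). }
  destruct (transitive_subset_ordinal c a Ha) as [->|Hca];
    [intros x Hx; apply Hc, Hx | exact c_trans | left; intros x Hx; apply Hc, Hx |].
  destruct (transitive_subset_ordinal c b Hb) as [->|Hcb];
    [intros x Hx; apply Hc, Hx | exact c_trans | right; exact Hca |].
  destruct (mem_irrefl c); apply Hc; auto.
Qed.

Lemma collapse_mem_injective (X f x y v : M) :
  trichotomous X -> collapse mem X f -> app f x v -> app f y v -> x = y.
Proof.
  intros X_tri [Hf f_spec] Hx Hy.
  destruct (X_tri x y) as [Hxy|[Hxy|Hyx]];
    [exact (app_dom f X x v Hf Hx) | exact (app_dom f X y v Hf Hy) | | exact Hxy |];
    destruct (mem_irrefl v).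
  - apply (f_spec y v Hy); eauto.
  - apply (f_spec x v Hx); eauto.
Qed.

Lemma collapse_mem_ordinal (X f V : M) :
  trichotomous X -> collapse mem X f -> surjection f X V -> ordinal V.
Proof.
  intros X_tri Hcf HfV; apply ordinal_of_trichotomous.
  - exact (collapse_transitive mem X f V Hcf HfV).
  - destruct Hcf as [Hf f_spec], HfV as [_ f_surj]; intros u v Hu Hv.
    destruct (f_surj u Hu) as [x Hx], (f_surj v Hv) as [y Hy].
    destruct (X_tri x y) as [Hxy|[<-|Hyx]];
      [exact (app_dom f X x u Hf Hx) | exact (app_dom f X y v Hf Hy) | | |].
    + left; apply (f_spec y v Hy); eauto.
    + right; left; exact (app_functional f X x u v Hf Hx Hy).
    + right; right; apply (f_spec x u Hx); eauto.
Qed.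

Lemma collapse_mem_maps_to (X f a : M) :
  trichotomous X -> collapse mem X f -> ordinal a -> ~ card_le a X -> maps_to f X a.
Proof.
  intros X_tri Hcf Ha a_not_le; pose proof (proj1 Hcf) as Hf.
  destruct (range_exists f X Hf) as [V HfV].
  pose proof (collapse_mem_ordinal X f V X_tri Hcf HfV) as HV.
  destruct HfV as [[_ f_range] f_surj].
  destruct (ordinal_subset_or_mem V a HV Ha) as [V_subset|HaV].
  - split; [exact Hf |]; intros x v Hv; exact (V_subset v (f_range x v Hv)).
  - destruct a_not_le; apply (card_le_of_relation (converse (app f))).
    + intros v Hv; destruct (f_surj v (proj1 HV a HaV v Hv)) as [x Hx].
      exists x; split; [exact (app_dom f X x v Hf Hx) | exact Hx].
    + intros v x y _ _ _; exact (collapse_mem_injective X f x y v X_tri Hcf).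
    + intros x v v' _ _ _; exact (app_functional f X x v v' Hf).
Qed.

(** * Coverings *)

Lemma Cov_subsets (L : M -> Prop) (m n : M) :
  Cov L m n ->
  exists B, function_on B m /\
    (forall j Bj, app B j Bj -> subset Bj n /\ exists K, L K /\ card_le Bj K) /\
    (forall y, y ∈ n -> exists j Bj, app B j Bj /\ y ∈ Bj).
Proof.
  intros (X & I & A & [g [[g_maps g_inj] [_ g_surj]]] & [h [[h_maps h_inj] [_ h_surj]]] &
    HA & A_size & A_cover).
  destruct h_maps as [Hh h_range]; pose proof (proj1 g_maps) as Hg.
  destruct (function_exists (fun j Bj => exists i Ai, app h i j /\ app A i Ai /\
    forall y, y ∈ Bj <-> y ∈ n /\ exists x, x ∈ Ai /\ app g x y) m) as (B & HB & B_app).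
  - intros j Hj; destruct (h_surj j Hj) as [i Hij].
    destruct (app_total A I i HA (app_dom h I i j Hh Hij)) as [Ai HAi].
    destruct (separation (fun y => exists x, x ∈ Ai /\ app g x y) n) as [Bj HBj].
    exists Bj, i, Ai; auto.
  - intros j Bj Bj' _ (i & Ai & Hij & HAi & HBj) (i' & Ai' & Hij' & HAi' & HBj').
    rewrite (h_inj i' i j Hij' Hij) in HAi'.
    rewrite (app_functional A I i Ai' Ai HA HAi' HAi) in HBj'.
    apply (zf_extensionality HZF); intro y; rewrite HBj, HBj'; reflexivity.
  - exists B; split; [exact HB | split].
    + intros j Bj HjB; apply B_app in HjB as (_ & i & Ai & _ & HAi & HBj).
      split; [intros y Hy; apply HBj, Hy | exists Ai; split; [exact (A_size i Ai HAi) |]].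
      apply (card_le_of_relation (converse (app g))).
      * intros y Hy; apply HBj in Hy as [_ Hy]; exact Hy.
      * intros y x x' _ _ _; apply g_inj.
      * intros x y y' _ _ _; exact (app_functional g X x y y' Hg).
    + intros y Hy; destruct (g_surj y Hy) as [x Hxy].
      destruct (A_cover x (app_dom g X x y Hg Hxy)) as (i & Ai & HAi & HxA).
      destruct (app_total h I i Hh (app_dom A I i Ai HA HAi)) as [j Hij].
      pose proof (h_range i j Hij) as Hj.
      destruct (app_total B m j HB Hj) as [Bj HjB]; exists j, Bj; split; [exact HjB |].
      apply B_app in HjB as (_ & i' & Ai' & Hij' & HAi' & HBj); apply HBj.
      rewrite (h_inj i' i j Hij' Hij) in HAi'.
      rewrite (app_functional A I i Ai' Ai HA HAi' HAi); eauto.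
Qed.

Lemma card_le_star_product_of_subsets (a m n P B : M) :
  ordinal a -> trichotomous n -> is_product P a m -> function_on B m ->
  (forall j Bj, app B j Bj -> subset Bj n /\ ~ card_le a Bj) ->
  (forall y, y ∈ n -> exists j Bj, app B j Bj /\ y ∈ Bj) ->
  card_le_star n P.
Proof.
  intros Ha n_tri HP HB B_small B_cover.
  apply (card_le_star_of_relation (fun p y => exists b j Bj f,
    is_pair p b j /\ app B j Bj /\ collapse mem Bj f /\ app f y b)).
  - intros p y y' _ _ _ (b & j & Bj & f & Hp & HBj & Hcf & Hy)
      (b' & j' & Bj' & f' & Hp' & HBj' & Hcf' & Hy').
    destruct (pair_inj p b j b' j' Hp Hp') as [<- <-].
    rewrite (app_functional B m j Bj' Bj HB HBj' HBj) in Hcf'.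
    destruct (B_small j Bj HBj) as [Bj_subset _].
    pose proof (trichotomous_subset Bj n Bj_subset n_tri) as Bj_tri.
    apply (collapse_mem_injective Bj f y y' b Bj_tri Hcf Hy).
    exact (collapse_app mem Bj f' f y' b Hcf' Hcf Hy').
  - intros y Hy; destruct (B_cover y Hy) as (j & Bj & HBj & HyB).
    destruct (B_small j Bj HBj) as [Bj_subset a_not_le].
    destruct (collapse_exists mem Bj (mem_well_founded_on Bj)) as [f Hcf].
    pose proof (trichotomous_subset Bj n Bj_subset n_tri) as Bj_tri.
    pose proof (collapse_mem_maps_to Bj f a Bj_tri Hcf Ha a_not_le) as f_maps.
    destruct (maps_to_total f Bj a f_maps y HyB) as (b & Hb & Hyb).
    destruct (pair_exists b j) as [p Hp]; exists p; split.
    + apply HP; exists b, j; split; [exact Hb | split; [| exact Hp]].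
      exact (app_dom B m j Bj HB HBj).
    + exists b, j, Bj, f; auto.
Qed.

Lemma Cov_lt_card_le_star_product (a m n P : M) :
  ordinal a -> ordinal n -> is_product P a m -> Cov_lt a m n -> card_le_star n P.
Proof.
  intros Ha Hn HP Hcov.
  destruct (Cov_subsets _ m n Hcov) as (B & HB & B_small & B_cover).
  apply (card_le_star_product_of_subsets a m n P B Ha (ordinal_trichotomous n Hn) HP HB);
    [| exact B_cover].
  intros j Bj HBj; destruct (B_small j Bj HBj) as (Bj_subset & K & HK & Bj_le).
  split; [exact Bj_subset |]; intro a_le.
  exact (card_lt_not_ge K a HK (card_le_trans a Bj K a_le Bj_le)).
Qed.

(** * Lindenbaum and Hartogs ordinals *)

Lemma ordinal_images_exist (N : M) :
  exists b, forall a, a ∈ b <-> ordinal a /\ exists f, surjection f N a.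
Proof.
  destruct (product_exists N N) as [NN HNN].
  destruct (zf_power HZF NN) as [PN HPN].
  destruct (replacement (fun W a => ordinal a /\
    exists f, surjection f N a /\ collapse (app W) N f) PN) as [b Hb].
  { intros W a a' _ (_ & f & Hf & Hcf) (_ & f' & Hf' & Hcf').
    exact (collapse_range_unique (app W) N f f' a a' Hcf Hcf' Hf Hf'). }
  exists b; intro a; rewrite Hb; split.
  - intros (W & _ & Ha & f & Hf & _); eauto.
  - intros [Ha [f Hf]].
    destruct (relation_exists (fun x y => exists u v, app f x u /\ app f y v /\ u ∈ v) N N)
      as (W & HW & W_pairs).
    exists W; split; [apply HPN; intros z Hz; apply HNN, W_pairs, Hz |].
    split; [exact Ha | exists f; split; [exact Hf |]].
    apply (surjection_collapse (app W) N f a (proj1 Ha) Hf).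
    pose proof (proj1 (proj1 Hf)) as f_fun; intros x y u v Hu Hv; rewrite HW; split.
    + intros (_ & _ & u' & v' & Hu' & Hv' & Huv).
      rewrite (app_functional f N x u u' f_fun Hu Hu').
      rewrite (app_functional f N y v v' f_fun Hv Hv'); exact Huv.
    + intro Huv; split; [exact (app_dom f N x u f_fun Hu) |].
      split; [exact (app_dom f N y v f_fun Hv) | eauto].
Qed.

Lemma lindenbaum_exists (N : M) : exists l, is_lindenbaum l N.
Proof.
  destruct (ordinal_images_exist N) as [b Hb].
  destruct (empty_set_exists N) as [o Ho].
  destruct (zf_pairing HZF o o) as [so Hso].
  destruct (binary_union_exists b so) as [l Hl].
  exists l; intro a; rewrite Hl, Hb, Hso; split.
  - intros [[Ha Hf]|Ha]; [split; [exact Ha | right; exact Hf] |].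
    assert (a = o) as -> by tauto; split; [exact (ordinal_empty o Ho) | left; exact Ho].
  - intros [Ha [a_empty|Hf]]; [right; left | left; auto].
    apply (zf_extensionality HZF); intro z; split; intro Hz;
      [destruct (a_empty z Hz) | destruct (Ho z Hz)].
Qed.

Lemma hartogs_exists (N : M) : exists h, is_hartogs h N.
Proof.
  destruct (lindenbaum_exists N) as [l Hl].
  destruct (separation (fun a => card_le a N) l) as [h Hh].
  exists h; intro a; rewrite Hh, (Hl a); split; [tauto |].
  intros [Ha HaN]; split; [split; [exact Ha |] | exact HaN].
  exact (card_le_le_star_trans a N N HaN (card_le_star_refl N)).
Qed.

Lemma hartogs_card_le_lindenbaum (X Y h l : M) :
  card_le_star X Y -> is_hartogs h X -> is_lindenbaum l Y -> card_le h l.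
Proof.
  intros HXY Hh Hl; apply card_le_subset; intros a Ha; apply Hh in Ha as [Ha HaX].
  apply Hl; split; [exact Ha | exact (card_le_le_star_trans a X Y HaX HXY)].
Qed.

End ZFModel.

Theorem theorem1 (M : structure) (HZF : ZF M) (lam nu m : M)
  (Hlam : initial_ordinal lam) (Hnu : initial_ordinal nu)
  (Hcov : Cov_lt lam m nu) :
  exists lam_m : M, is_product lam_m lam m /\
    card_le_star nu lam_m /\
    exists nu_plus aleph_star : M,
      is_hartogs nu_plus nu /\
      is_lindenbaum aleph_star lam_m /\
      card_le nu_plus aleph_star.
Proof.
  destruct (product_exists HZF lam m) as [P HP].
  pose proof (Cov_lt_card_le_star_product HZF lam m nu P (proj1 Hlam) (proj1 Hnu) HP Hcov)
    as nu_le.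
  destruct (hartogs_exists HZF nu) as [h Hh].
  destruct (lindenbaum_exists HZF P) as [l Hl].
  exists P; split; [exact HP | split; [exact nu_le |]].
  exists h, l; split; [exact Hh | split; [exact Hl |]].
  exact (hartogs_card_le_lindenbaum HZF nu P h l nu_le Hh Hl).
Qed.
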